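(* Let $F$ be a field of characteristic $0$ and let $L$ be a finite-dimensional $n$-ary algebra over $F$ such that $\mathrm{QDer}_{KS}(L)=\mathrm{End}(L)$. Then: 1) If $L$ is commutative, then $L\cong L_\alpha$ for some $\alpha\in F$. Moreover, if the base field $F$ of $L$ is algebraically closed, then one can define a binary multiplication $\cdot$ in $L$ such that $(L,\cdot)\cong F$ and $[x_1,\ldots,x_n]=x_1\cdot\ldots\cdot x_n$ for $x_1,\ldots,x_n\in L$, where $[\cdot,\ldots,\cdot]$ is the multiplication in $L$. 2) If $L$ is anticommutative, then $L\cong L_B$ for a nondegenerate $(n+1)\times(n+1)$-matrix $B$, or $L$ has zero multiplication. Moreover, if $L$ is a Filippov algebra and the base field is algebraically closed, then $L\cong D_{n+1}$.
   Context: An $n$-ary algebra over $F$ is a vector space $L$ with an $n$-linear map $[\cdot,\ldots,\cdot]:L^n\to L$. It is commutative if $[x_{\sigma(1)},\ldots,x_{\sigma(n)}]=[x_1,\ldots,x_n]$ for all $\sigma\in S_n$, and anticommutative if $[x_{\sigma(1)},\ldots,x_{\sigma(n)}]=\mathrm{sgn}(\sigma)[x_1,\ldots,x_n]$ for all $\sigma\in S_n$ ($\mathrm{sgn}(\sigma)=\pm1$ is the sign of $\sigma$). A Filippov ($n$-Lie) algebra is an anticommutative $n$-ary algebra with $[[x_1,\ldots,x_n],y_2,\ldots,y_n]=\sum_{i=1}^n[x_1,\ldots,[x_i,y_2,\ldots,y_n],\ldots,x_n]$. $\mathrm{End}(L)$ is the space of all linear maps $L\to L$. $\mathrm{QDer}_{KS}(L)$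 (quasiderivations in the sense of Kaygorodov and Shestakov) is the set of $d\in\mathrm{End}(L)$ for which there is $f\in\mathrm{End}(L)$ with $d([a_1,\ldots,a_n])=\sum_{i=1}^n[a_1,\ldots,a_{i-1},f(a_i),a_{i+1},\ldots,a_n]$ for all $a_1,\ldots,a_n\in L$. $L_\alpha$ ($\alpha\in F$): the one-dimensional $n$-ary algebra $Fv$ with $[v,\ldots,v]=\alpha v$. $L_B$, for an $(n+1)\times(n+1)$-matrix $B=(\beta_{ij})$ over $F$: the $(n+1)$-dimensional anticommutative $n$-ary algebra with basis $e_1,\ldots,e_{n+1}$ in which, setting $e^i=(-1)^{n+i+1}[e_1,\ldots,\hat{e_i},\ldots,e_{n+1}]$ ($\hat{\ }$ denotes omission), one has $e^i=\beta_{1i}e_1+\cdots+\beta_{n+1,i}e_{n+1}$ for $i=1,\ldots,n+1$. $D_{n+1}$: the anticommutative $n$-ary algebra with basis $e_1,\ldots,e_{n+1}$ and $[e_1,\ldots,\hat{e_i},\ldots,e_{n+1}]=(-1)^{n+i+1}e_i$, i.e. $D_{n+1}=L_I$ with $I$ the identity matrix.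
   Formalization: The alternative ''or L has zero multiplication'' is added to part 1), to its ''moreover'', and to the Filippov claim in 2), since zero algebras are counterexamples; n ≥ 2 is assumed, since for n = 1 the bracket [x] = x on a 3-dimensional space is a counterexample. *)

(* Defs.v *)
From HB Require Import structures.
From mathcomp Require Import all_boot all_order all_fingroup all_algebra.

Set Implicit Arguments.
Unset Strict Implicit.
Unset Printing Implicit Defensive.

Import GRing.Theory.
Local Open Scope ring_scope.

Definition upd (T : Type) (n : nat) (x : {ffun 'I_n -> T}) (i : 'I_n) (v : T) :
    {ffun 'I_n -> T} :=
  [ffun j => if j == i then v else x j].

Definition multilinear (F : fieldType) (n : nat) (V W : vectType F)
    (mu : {ffun 'I_n -> V} -> W) : Prop :=
  forall (x : {ffun 'I_n -> V}) (i : 'I_n), linear (fun v => mu (upd x i v)).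

(* Finite-dimensionality is part of [vectType]. *)
Record naryAlg (F : fieldType) (n : nat) := NaryAlg {
  nary_sort :> vectType F;
  bracket : {ffun 'I_n -> nary_sort} -> nary_sort;
  bracket_multilinear : multilinear bracket
}.

Arguments bracket {F n} L x : rename.

Section NaryAlgebras.
Variables (F : fieldType) (n : nat).
Implicit Type L : naryAlg F n.

Definition nary_commutative L : Prop :=
  forall (s : 'S_n) (x : {ffun 'I_n -> L}),
    bracket L [ffun i => x (s i)] = bracket L x.

Definition nary_anticommutative L : Prop :=
  forall (s : 'S_n) (x : {ffun 'I_n -> L}),
    bracket L [ffun i => x (s i)] = (-1) ^+ s *: bracket L x.

Definition zero_multiplication L : Prop :=
  forall x : {ffun 'I_n -> L}, bracket L x = 0.

(* [upd y z v], with [z] the first index, is (v, y_2, ..., y_n): the first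
   entry of [y] is never used. *)
Definition filippov L : Prop :=
  nary_anticommutative L /\
  forall (x y : {ffun 'I_n -> L}) (z : 'I_n), z = 0%N :> nat ->
    bracket L (upd y z (bracket L x)) =
    \sum_(i < n) bracket L (upd x i (bracket L (upd y z (x i)))).

Definition QDerKS L (d : 'End(L)) : Prop :=
  exists f : 'End(L), forall a : {ffun 'I_n -> L},
    d (bracket L a) = \sum_(i < n) bracket L (upd a i (f (a i))).

Definition nary_iso (L1 L2 : naryAlg F n) : Prop :=
  exists phi : 'Hom(L1, L2), bijective phi /\
    forall x : {ffun 'I_n -> L1},
      phi (bracket L1 x) = bracket L2 [ffun i => phi (x i)].

(* (V, mul) is isomorphic to F as an F-algebra; this forces [mul] to be
   bilinear. *)
Definition iso_base_field (V : vectType F) (mul : V -> V -> V) : Prop :=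
  exists phi : 'Hom(V, F^o), bijective phi /\
    forall x y : V, phi (mul x y) = phi x * phi y.

(* The left-normed product x_1 . x_2 . ... . x_n (0 if n = 0). *)
Definition iterated_mul (V : vectType F) (mul : V -> V -> V)
    (x : {ffun 'I_n -> V}) : V :=
  let s := [seq x i | i <- enum 'I_n] in foldl mul (head 0 s) (behead s).

Definition La_bracket (a : F) (x : {ffun 'I_n -> F^o}) : F^o :=
  a * \prod_(i < n) (x i : F).

Lemma La_bracket_multilinear a : multilinear (La_bracket a).
Proof.
move=> x i c u v; rewrite /La_bracket.
have E w : \prod_j (upd x i w j : F) = w * \prod_(j | j != i) (x j : F).
  rewrite (bigD1 i) //= ffunE eqxx; congr (_ * _).
  by apply: eq_bigr => j /negbTE ji; rewrite ffunE ji.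
by rewrite !E mulrDl mulrDr -[c *: u]/(c * u) -mulrA mulrCA.
Qed.

Definition La (a : F) : naryAlg F n := NaryAlg (La_bracket_multilinear a).

Lemma La_basis a : bracket (La a) [ffun=> (1 : F^o)] = a *: (1 : F^o).
Proof.
by congr (a * _); rewrite big1 // => i _; rewrite ffunE.
Qed.

(* Row j is the j-th argument; deleting column i leaves the minor giving the
   coefficient of [e_1, ..., ^e_i, ..., e_(n+1)] in the bracket. *)
Definition args_mx (x : {ffun 'I_n -> 'rV[F]_n.+1}) : 'M[F]_(n, n.+1) :=
  \matrix_(j, k) x j 0 k.

(* Indices start from 0 here, so that (-1)^(n+i+1) becomes (-1)^(n+i), and
   e^i = \sum_k B k i e_k is the transpose of column i of B.  See [LB_basis]
   and [LB_anticommutative] below for the defining properties. *)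
Definition LB_bracket (B : 'M[F]_n.+1) (x : {ffun 'I_n -> 'rV[F]_n.+1}) :
    'rV[F]_n.+1 :=
  \sum_(i < n.+1) ((-1) ^+ (n + i) * \det (col' i (args_mx x))) *: (col i B)^T.

Lemma LB_bracket_multilinear B : multilinear (LB_bracket B).
Proof.
move=> x j c u v; rewrite /LB_bracket scaler_sumr -big_split /=.
apply: eq_bigr => i _; rewrite scalerA -scalerDl; congr (_ *: _).
set A := args_mx _; set A1 := args_mx _; set A2 := args_mx _.
rewrite (@determinant_multilinear _ _ (col' i A) (col' i A1) (col' i A2) j c 1).
- by rewrite mul1r mulrDr mulrCA.
- by apply/rowP => k; rewrite !mxE !ffunE eqxx !mxE mul1r.
- by apply/matrixP => p q; rewrite !mxE !ffunE eq_sym (negbTE (neq_lift _ _)).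
- by apply/matrixP => p q; rewrite !mxE !ffunE eq_sym (negbTE (neq_lift _ _)).
Qed.

Definition LB (B : 'M[F]_n.+1) : naryAlg F n :=
  NaryAlg (LB_bracket_multilinear B).

Lemma LB_anticommutative B : nary_anticommutative (LB B).
Proof.
move=> s x; rewrite /= /LB_bracket scaler_sumr; apply: eq_bigr => i _.
rewrite scalerA mulrCA; congr (_ * _ *: _).
rewrite -det_perm -det_mulmx -row_permE; congr (\det _).
by apply/matrixP => p q; rewrite !mxE ffunE.
Qed.

Lemma LB_basis B (i : 'I_n.+1) :
  (-1) ^+ (n + i) *:
    bracket (LB B) [ffun j => (delta_mx 0 (lift i j) : 'rV[F]_n.+1)] =
  \sum_(k < n.+1) B k i *: (delta_mx 0 k : 'rV[F]_n.+1).
Proof.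
rewrite /= /LB_bracket (bigD1 i) //= [X in _ + X]big1 => [|k ki]; last first.
  have [k' k'E] : exists k', i = lift k k'.
    by case: (unliftP k i) => [k' ->|e]; [exists k' | rewrite e eqxx in ki].
  have -> : \det (col' k (args_mx
      [ffun j => (delta_mx 0 (lift i j) : 'rV[F]_n.+1)])) = 0.
    rewrite (expand_det_col _ k') big1 // => p _.
    by rewrite !mxE ffunE mxE -k'E (negbTE (neq_lift _ _)) andbF mul0r.
  by rewrite mulr0 scale0r.
have -> : col' i (args_mx
    [ffun j => (delta_mx 0 (lift i j) : 'rV[F]_n.+1)]) = 1%:M.
  apply/matrixP => p q; rewrite !mxE ffunE mxE eqxx /=.
  by rewrite (inj_eq lift_inj) eq_sym.
rewrite det1 mulr1 addr0 scalerA -expr2 sqrr_sign scale1r.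
rewrite [LHS]row_sum_delta; apply: eq_bigr => k _; by rewrite !mxE.
Qed.

Definition Dalg : naryAlg F n := LB 1%:M.

Lemma Dalg_basis (i : 'I_n.+1) :
  bracket Dalg [ffun j => (delta_mx 0 (lift i j) : 'rV[F]_n.+1)] =
  (-1) ^+ (n + i) *: (delta_mx 0 i : 'rV[F]_n.+1).
Proof.
have := LB_basis 1%:M i; rewrite (bigD1 i) //= big1 => [|k ki].
  rewrite mxE eqxx scale1r addr0 => <-.
  by rewrite scalerA -expr2 sqrr_sign scale1r.
by rewrite mxE (negbTE ki) scale0r.
Qed.

End NaryAlgebras.

Arguments La {F} n a.
Arguments LB {F n} B.
Arguments Dalg F n : clear implicits.

(* Main.v *)
Require Import Defs.
From HB Require Import structures.
From mathcomp Require Import all_boot all_order all_fingroup all_algebra.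

(** Write [d . mu = mu . f] for the relation
      d [a_1, ..., a_n] = sum_i [a_1, ..., f a_i, ..., a_n].
    The hypothesis gives an f for every d. Suppose that the bracket mu is not
    zero. Then the brackets span L: the span of the brackets is stable under
    every d, and End(L) moves a nonzero vector anywhere ([brackets_span]). So d
    is determined by [d . mu], and a linear choice of f as a function of d is
    injective, hence bijective, because End(L) is finite-dimensional: every f
    is intertwined with some d ([every_lfun_intertwined]). In other words, mu
    is a surjective gl(L)-equivariant map from the n-th symmetric or exterior
    power of L onto a gl(L)-module of dimension dim L. As these powers are
    irreducible in characteristic 0, mu must be injective on them, which leaves
    very few dimensions.

    This is carried out on a basis e_1, ..., e_m, without building the
    powers. A diagonal f makes every bracket of basis vectors an eigenvector
    of d, with the sum of the weights of its entries as eigenvalue; at most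
    m of these eigenvalues are distinct ([card_weights_le_dim]). An
    elementary matrix f replaces one entry of a basis tuple by another basis
    vector, so the vanishing of one basis bracket spreads to its neighbours
    and finally to all of them. Since mu is not zero, no basis bracket
    vanishes, except those with repeated entries in the anticommutative
    case.

    In the commutative case, m > 1 would give m + 1 distinct weights, of [e_i,
    ..., e_i] and [e_2, e_1, ..., e_1]; so m = 1, and rescaling the
    generator by a root of degree n - 1 turns the bracket into the product
    of F.

    In the anticommutative case, the weights 2^i separate the n-subsets of
    the basis, so binomial(m, n) <= m, that is, m = n or m = n + 1. If m =
    n, the brackets span only a line, against [brackets_span]. If m = n + 1,
    the coordinates of L in a basis identify it with some L_B, and B is
    invertible because the brackets span.

    For the Filippov part, the bracket of D_{n+1} is the generalized cross
    product: the scalar product of cross x with z is the determinant with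
    rows x_1, ..., x_n, z ([cross_dot]); and [x] = (cross x) B^T in L_B
    ([LB_cross]). The map v -> cross (v, y_2, ..., y_n) has a skew matrix W,
    and expanding the Filippov identity by [cross_derivation] gives (B^T -
    B) W = tr(W B^T) I. W is singular, so both sides vanish, and since the
    matrices W have no common left annihilator, B is symmetric
    ([filippov_LB_sym]). Over an algebraically closed field the form B then
    has an orthonormal basis Q, and x -> x (t Q^T), for a suitable scalar t,
    is an isomorphism from L_B to D_{n+1} ([LB_sym_iso_Dalg]). *)

Set Implicit Arguments.
Unset Strict Implicit.
Unset Printing Implicit Defensive.

Import GRing.Theory passmx.
Local Open Scope ring_scope.

(** * Multilinear maps on basis tuples *)

Section Tuples.
Variable n : nat.

Lemma updE (T : Type) (x : {ffun 'I_n -> T}) i v j :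
  upd x i v j = if j == i then v else x j.
Proof. by rewrite ffunE. Qed.

Lemma upd_id (T : Type) (x : {ffun 'I_n -> T}) i : upd x i (x i) = x.
Proof. by apply/ffunP => j; rewrite updE; case: eqP => [->|]. Qed.

Definition basis_args (F : fieldType) (V : vectType F) m (e : m.-tuple V)
  (f : {ffun 'I_n -> 'I_m}) : {ffun 'I_n -> V} := [ffun i => e`_(f i)].

Lemma basis_args_upd (F : fieldType) (V : vectType F) m (e : m.-tuple V)
    (f : {ffun 'I_n -> 'I_m}) i a :
  basis_args e (upd f i a) = upd (basis_args e f) i e`_a.
Proof. by apply/ffunP => j; rewrite !ffunE; case: eqP. Qed.

Lemma basis_args_perm (F : fieldType) (V : vectType F) m (e : m.-tuple V)
    (f : {ffun 'I_n -> 'I_m}) (s : 'S_n) :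
  basis_args e [ffun i => f (s i)] = [ffun i => basis_args e f (s i)].
Proof. by apply/ffunP => j; rewrite !ffunE. Qed.

End Tuples.

Section Multilinear.
Variables (F : fieldType) (n : nat) (V W : vectType F).
Implicit Types (mu : {ffun 'I_n -> V} -> W).

(** The proof of multilinearity is an argument, so that the linear structure
    below can be inferred for a single argument of any multilinear map. *)
Definition slot mu (mlin : multilinear mu) x i (v : V) : W := mu (upd x i v).

HB.instance Definition _ mu (mlin : multilinear mu) x i :=
  GRing.isLinear.Build F V W *:%R (slot mlin x i) (mlin x i).

(** The arguments are expanded in the basis one at a time: outside the list
    [r] of the arguments still to be expanded, all entries are basis
    vectors. *)
Lemma multilinear_mem mu m (e : m.-tuple V) (U : {vspace W}) :
  multilinear mu -> basis_of fullv e ->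
  (forall f, mu (basis_args e f) \in U) -> forall x, mu x \in U.
Proof.
move=> lin eP E.
suff P (r : seq 'I_n) (x : {ffun 'I_n -> V}) :
    (forall i, i \notin r -> exists j : 'I_m, x i = e`_j) -> mu x \in U.
  by move=> x; apply: (P (enum 'I_n)) => i; rewrite mem_enum.
elim: r x => [|i r IHr] x xP.
  have [f fP] := fin_all_exists (fun i => xP i isT).
  suff -> : x = basis_args e (finfun f) by apply: E.
  by apply/ffunP => i; rewrite !ffunE.
rewrite -(upd_id x i) (coord_basis eP (memvf (x i))) -/(slot lin x i _).
rewrite linear_sum; apply: memv_suml => j _; rewrite linearZ; apply: memvZ.
apply: IHr => k kr; rewrite updE; case: eqP => [_|/eqP ki]; first by exists j.
by apply: xP; rewrite inE negb_or ki.
Qed.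

Lemma multilinear_ext mu1 mu2 m (e : m.-tuple V) :
  multilinear mu1 -> multilinear mu2 -> basis_of fullv e ->
  (forall f, mu1 (basis_args e f) = mu2 (basis_args e f)) -> mu1 =1 mu2.
Proof.
move=> lin1 lin2 eP E x; apply/eqP; rewrite -subr_eq0 -memv0.
apply: (multilinear_mem (mu := fun x => mu1 x - mu2 x) _ eP) => [y i c u v|f].
  by rewrite lin1 lin2 scalerBr opprD addrACA.
by rewrite E subrr mem0v.
Qed.

Lemma multilinear_eq0 mu m (e : m.-tuple V) :
  multilinear mu -> basis_of fullv e ->
  (forall f, mu (basis_args e f) = 0) -> forall x, mu x = 0.
Proof.
move=> lin eP E x; apply/eqP; rewrite -memv0.
by apply: (multilinear_mem lin eP) => f; rewrite E mem0v.
Qed.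

Lemma multilinear_hom (W' : vectType F) (g : 'Hom(W, W')) mu :
  multilinear mu -> multilinear (fun x => g (mu x)).
Proof. by move=> lin x i c u v; rewrite lin linearP. Qed.

End Multilinear.

Section LinearAlgebra.
Variables (F : fieldType) (V : vectType F).

Lemma exists_lfun_sending (v w : V) : v != 0 -> exists g : 'End(V), g v = w.
Proof.
move=> v0; have fv : free [tuple v] by rewrite seq1_free.
have [g gP] := linear_of_free [tuple v] [:: w]; exists (linfun g).
by have [] := gP fv erefl; rewrite lfunE.
Qed.

Lemma exists_lfun_on_basis m (e : m.-tuple V) (v : 'I_m -> V) :
  basis_of fullv e -> exists g : 'End(V), forall i : 'I_m, g e`_i = v i.
Proof.
move=> eP; have [g gP] := linear_of_free e [tuple v i | i < m].
exists (linfun g) => i; rewrite lfunE.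
have ge : [seq g u | u <- e] = [tuple v i | i < m].
  by apply: gP; rewrite ?(basis_free eP) ?size_tuple.
by rewrite -(nth_map 0 0) ?size_tuple // ge -tnth_nth tnth_mktuple.
Qed.

(** The values of [a] are distinct roots of the characteristic polynomial of
    [g]. *)
Lemma card_eigenvalues_le_dim (g : 'End(V)) (I : finType) (A : {set I})
    (a : I -> F) (w : I -> V) :
  {in A &, injective a} -> {in A, forall i, w i != 0} ->
  {in A, forall i, g (w i) = a i *: w i} -> (#|A| <= \dim {:V})%N.
Proof.
move=> a_inj w0 gw; have eP := vbasisP {:V}; set e := vbasis _ in eP.
have rt i : i \in A -> root (char_poly (mxof e e g)) (a i).
  move=> Ai; rewrite -eigenvalue_root_char; apply/eigenvalueP.
  exists (rVof e (w i)); last by rewrite rVof_eq0 ?w0.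
  by rewrite -rVof_app // gw // linearZ.
rewrite cardE -(size_map a) -ltnS -(size_char_poly (mxof e e g)).
apply: max_poly_roots; first by rewrite monic_neq0 ?char_poly_monic.
  by apply/allP => _ /mapP[i iA ->]; apply: rt; rewrite -mem_enum.
rewrite map_inj_in_uniq ?enum_uniq // => i j; rewrite !mem_enum.
exact: a_inj.
Qed.

End LinearAlgebra.

Lemma multilinear_comp_args (F : fieldType) n (V V' W : vectType F)
    (g : 'Hom(V', V)) (mu : {ffun 'I_n -> V} -> W) :
  multilinear mu -> multilinear (fun x => mu [ffun i => g (x i)]).
Proof.
move=> lin x i c u v.
have E w : [ffun j => g (upd x i w j)] = upd [ffun j => g (x j)] i (g w).
  by apply/ffunP => j; rewrite !ffunE; case: eqP.
by rewrite !E linearP lin.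
Qed.

Lemma linfunP (F : fieldType) (V W : vectType F) (f : V -> W) :
  linear f -> exists g : 'Hom(V, W), g =1 f.
Proof.
move=> lin; pose fl : {linear V -> W} :=
  HB.pack f (GRing.isLinear.Build F V W *:%R f lin).
by exists (linfun fl) => v; rewrite lfunE.
Qed.

Lemma bijective_coords (F : fieldType) (V : vectType F) m (e : m.-tuple V) :
  basis_of fullv e ->
  exists phi : 'Hom(V, 'rV[F]_m), bijective phi /\
    forall j : 'I_m, phi e`_j = delta_mx 0 j.
Proof.
move=> eP; have fe := basis_free eP.
have [phi phiE] : exists phi : 'Hom(V, 'rV_m),
    phi =1 (fun v => \row_j coord e j v).
  by apply: linfunP => c u v; apply/rowP => j; rewrite !mxE linearP.
exists phi; split=> [|j].
  exists (fun r : 'rV_m => \sum_j r 0 j *: e`_j) => [v|r].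
    rewrite [RHS](coord_basis eP (memvf v)); apply: eq_bigr => j _.
    by rewrite phiE mxE.
  by apply/rowP => j; rewrite phiE mxE coord_sum_free.
by rewrite phiE; apply/rowP => k; rewrite !mxE eqxx coord_free // eq_sym.
Qed.

Lemma closed_field_root (F : fieldType) k (a : F) :
  GRing.closed_field_axiom F -> (0 < k)%N -> exists c, c ^+ k = a.
Proof.
move=> clF; case: k => // k _.
have [c cE] := clF k.+1 (fun i => if i == 0%N then a else 0) isT.
exists c; rewrite cE big_ord_recl /= mulr1 big1 ?addr0 // => i _.
by rewrite mul0r.
Qed.

(** * Every endomorphism is intertwined *)

Section Quasiderivations.
Variables (F : fieldType) (n : nat) (L : naryAlg F n).
Implicit Types d f : 'End(L).

(** The quasiderivation condition as a relation: what is given is an [f] for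
    every [d], what is used is a [d] for every [f]. *)
Definition intertwines d f := forall a : {ffun 'I_n -> L},
  d (bracket L a) = \sum_(i < n) bracket L (upd a i (f (a i))).

Lemma intertwines0 : intertwines 0 0.
Proof.
move=> a; rewrite zero_lfunE big1 // => i _; rewrite zero_lfunE.
by rewrite -[LHS]/(slot (@bracket_multilinear _ _ L) a i 0) linear0.
Qed.

Lemma intertwinesP c d f d' f' : intertwines d f -> intertwines d' f' ->
  intertwines (c *: d + d') (c *: f + f').
Proof.
move=> H H' a; rewrite !lfunE /= lfunE /= H H' scaler_sumr -big_split /=.
apply: eq_bigr => i _; rewrite !lfunE /= lfunE /=.
by rewrite (@bracket_multilinear _ _ L).
Qed.

Lemma intertwines_sum I (r : seq I) (c : I -> F) (d f : I -> 'End(L)) :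
  (forall i, intertwines (d i) (f i)) ->
  intertwines (\sum_(i <- r) c i *: d i) (\sum_(i <- r) c i *: f i).
Proof.
move=> H; apply: (big_rec2 intertwines) => [|i d' f' _].
  exact: intertwines0.
exact: intertwinesP.
Qed.

Variable a0 : {ffun 'I_n -> L}.
Hypothesis a0_neq0 : bracket L a0 != 0.
Hypothesis QDerE : forall d : 'End(L), QDerKS d.

(** Some endomorphism [d] sends a given nonzero bracket to any prescribed
    vector, and a quasiderivation maps brackets to sums of brackets. *)
Lemma brackets_span (U : {vspace L}) :
  (forall a, bracket L a \in U) -> U = fullv.
Proof.
move=> UP; apply/vspaceP => w; rewrite memvf.
have [d <-] := exists_lfun_sending w a0_neq0; have [f ->] := QDerE d.
by rewrite memv_suml.
Qed.

Lemma eq_lfun_on_brackets d d' :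
  (forall a, d (bracket L a) = d' (bracket L a)) -> d = d'.
Proof.
move=> E; apply/lfunP => w; apply/eqlfunP.
by rewrite (brackets_span (U := lker (d - d'))) ?memvf // => a; apply/eqlfunP.
Qed.

(** Witnesses chosen on a basis of End(L) extend to a linear map [T] with
    [d] intertwined with [T d]. If [T d = T d'], then [d] and [d'] agree on
    brackets, hence are equal; so [T] is an injective endomorphism of the
    finite-dimensional space End(L), and therefore surjective. *)
Lemma every_lfun_intertwined f : exists d, intertwines d f.
Proof.
have EP := vbasisP {:'End(L)}; set E := vbasis _ in EP.
have [fs fsP] : exists fs,
    forall i : 'I_(\dim {:'End(L)}), intertwines E`_i (fs i).
  apply: (@fin_all_exists _ _ (fun i f => intertwines E`_(i : 'I_ _) f)) => i.
  exact: QDerE.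
have [T TE] := exists_lfun_on_basis fs EP.
have TP d : intertwines d (T d).
  rewrite (coord_basis EP (memvf d)) linear_sum.
  under [X in intertwines _ X]eq_bigr do rewrite linearZ /= TE.
  by apply: intertwines_sum.
have T0 : lker T == 0%VS.
  apply/lker0P => d d' Td; apply: eq_lfun_on_brackets => a.
  by rewrite (TP d) (TP d') Td.
by exists (T^-1%VF f); rewrite -{2}(lker0_lfunVK T0 f).
Qed.

End Quasiderivations.

(** * Weights of basis brackets *)

Section Weights.
Variables (F : fieldType) (n : nat) (L : naryAlg F n).
Variables (m : nat) (e : m.-tuple L).
Hypothesis charF0 : [pchar F] =i pred0.
Hypothesis e_basis : basis_of fullv e.
Hypothesis QDerE : forall d : 'End(L), QDerKS d.
Implicit Types f g : {ffun 'I_n -> 'I_m}.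

Lemma natr_inj : injective (fun k => k%:R : F).
Proof.
suff H j k : (j <= k)%N -> j%:R = k%:R :> F -> j = k.
  by move=> j k /= E; case/orP: (leq_total j k) => ?; [|apply: esym]; apply: H.
move=> le_jk E; apply/eqP; rewrite eqn_leq le_jk -subn_eq0.
by rewrite -((pcharf0P F).1 charF0) natrB // E subrr eqxx.
Qed.

Lemma bracket0 (a : {ffun 'I_n -> L}) i : bracket L (upd a i 0) = 0.
Proof.
by rewrite -[LHS]/(slot (@bracket_multilinear _ _ L) a i 0) linear0.
Qed.

Lemma bracketZ (a : {ffun 'I_n -> L}) i c v :
  bracket L (upd a i (c *: v)) = c *: bracket L (upd a i v).
Proof.
by rewrite -[LHS]/(slot (@bracket_multilinear _ _ L) a i (c *: v)) linearZ.
Qed.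

Variable f0 : {ffun 'I_n -> 'I_m}.
Hypothesis f0_neq0 : bracket L (basis_args e f0) != 0.

(** For the endomorphism given by the elementary matrix that sends the basis
    vector of index [b] to that of index [a] and kills the others, the
    Leibniz sum keeps the entries equal to [b] only. *)
Lemma basis_shift f a b : exists d : 'End(L), d (bracket L (basis_args e f)) =
  \sum_(i < n | f i == b) bracket L (basis_args e (upd f i a)).
Proof.
have [h hE] :=
  exists_lfun_on_basis (fun j => if j == b then e`_a else 0) e_basis.
have [d dh] := every_lfun_intertwined f0_neq0 QDerE h; exists d.
rewrite dh [RHS]big_mkcond; apply: eq_bigr => i _.
by rewrite ffunE hE basis_args_upd; case: eqP => // _; rewrite bracket0.
Qed.

(** For the diagonal endomorphism with eigenvalues [wt j], the bracket of a
    basis tuple is an eigenvector of the intertwined endomorphism, with the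
    sum of the weights of its entries as eigenvalue. Integer weights stay
    distinct in F, which has characteristic 0. *)
Lemma card_weights_le_dim (I : finType) (A : {set I})
    (f : I -> {ffun 'I_n -> 'I_m}) (wt : 'I_m -> nat) :
  {in A, forall i, bracket L (basis_args e (f i)) != 0} ->
  {in A &, injective (fun i => \sum_(k < n) wt (f i k))%N} -> (#|A| <= m)%N.
Proof.
move=> fA wtA; rewrite -(size_basis e_basis).
have [h hE] := exists_lfun_on_basis (fun j : 'I_m => (wt j)%:R *: e`_j) e_basis.
have [d dh] := every_lfun_intertwined f0_neq0 QDerE h.
pose w i := bracket L (basis_args e (f i)).
apply: (@card_eigenvalues_le_dim _ _ d _ _
  (fun i => (\sum_(k < n) wt (f i k))%N%:R) w) => //.
  by move=> i j Ai Aj /natr_inj; apply: wtA.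
move=> i Ai; rewrite dh natr_sum scaler_suml; apply: eq_bigr => k _.
by rewrite [basis_args _ _ k]ffunE hE bracketZ -basis_args_upd upd_id.
Qed.

End Weights.

(** * Commutative algebras *)

(** Any tuple is reached from any other by changing one entry at a time. *)
Lemma upd_closed_everywhere n m (Z : {ffun 'I_n -> 'I_m} -> Prop) f g :
  (forall f i a, Z f -> Z (upd f i a)) -> Z f -> Z g.
Proof.
move=> Zupd Zf; pose mix (r : seq 'I_n) : {ffun 'I_n -> 'I_m} :=
  [ffun j => if j \in r then g j else f j].
suff Zmix r : Z (mix r).
  suff <- : mix (enum 'I_n) = g by apply: Zmix.
  by apply/ffunP => j; rewrite ffunE mem_enum.
elim: r => [|i r IHr].
  by rewrite (_ : mix [::] = f) //; apply/ffunP => j; rewrite ffunE.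
rewrite (_ : mix (i :: r) = upd (mix r) i (g i)); first exact: Zupd.
by apply/ffunP => j; rewrite !ffunE inE; case: eqP => [->|].
Qed.

Section Commutative.
Variables (F : fieldType) (n : nat) (L : naryAlg F n).
Variables (m : nat) (e : m.-tuple L) (f0 : {ffun 'I_n -> 'I_m}).
Hypothesis charF0 : [pchar F] =i pred0.
Hypothesis e_basis : basis_of fullv e.
Hypothesis QDerE : forall d : 'End(L), QDerKS d.
Hypothesis f0_neq0 : bracket L (basis_args e f0) != 0.
Hypothesis commL : nary_commutative L.
Implicit Type f : {ffun 'I_n -> 'I_m}.

(** Shifting the index [f i] to [a] produces one term for each occurrence of
    [f i] in [f]; by commutativity all these terms are equal, and their
    number is a nonzero scalar. *)
Lemma commutative_upd_eq0 f i a :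
  bracket L (basis_args e f) = 0 -> bracket L (basis_args e (upd f i a)) = 0.
Proof.
move=> f_0; have [d] := basis_shift e_basis QDerE f0_neq0 f a (f i).
rewrite f_0 linear0.
rewrite (eq_bigr (fun=> bracket L (basis_args e (upd f i a)))).
  rewrite sumr_const -scaler_nat => /esym/eqP.
  rewrite scaler_eq0 ((pcharf0P F).1 charF0) => /orP[|/eqP//].
  by move/eqP/card0_eq/(_ i); rewrite unfold_in /= [eqn _ _]eqxx.
move=> k /eqP fk; rewrite -(commL (tperm i k)) -basis_args_perm.
congr (bracket L (basis_args e _)); apply/ffunP => j.
rewrite !ffunE; case: tpermP => [->|->|/eqP/negbTE-> /eqP/negbTE->] //.
  by rewrite !eqxx.
by rewrite eq_sym fk.
Qed.

(** With weights 1, ..., m, the tuples (e_i, ..., e_i) have the total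
    weights n i, and (e_2, e_1, ..., e_1) has weight n + 1, which is not a
    multiple of n. If m > 1, these are m + 1 distinct weights. *)
Lemma commutative_dim1 : (2 <= n)%N -> m = 1%N.
Proof.
move=> n2; have nK := ltn_predK n2; pose o := Ordinal (ltnW n2).
have nz f : bracket L (basis_args e f) != 0.
  apply/eqP => f_0; move: f0_neq0; apply/negP; rewrite negbK; apply/eqP.
  pose Z f' := bracket L (basis_args e f') = 0.
  by apply: (upd_closed_everywhere (Z := Z)) f_0; apply: commutative_upd_eq0.
have m_gt0 : (0 < m)%N by apply: leq_ltn_trans (ltn_ord (f0 o)).
apply/eqP; rewrite eqn_leq m_gt0 andbT leqNgt; apply/negP => m_gt1.
(* [None] stands for the mixed tuple (e_2, e_1, ..., e_1). *)
pose fam (x : option 'I_m) : {ffun 'I_n -> 'I_m} :=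
  if x is Some i then [ffun=> i]
  else upd [ffun=> Ordinal m_gt0] o (Ordinal m_gt1).
have famN : (\sum_(k < n) (fam None k).+1 = n.+1)%N.
  rewrite (bigD1 o) //= ffunE eqxx.
  rewrite (eq_bigr (fun=> 1%N)) => [|k /negbTE ko]; last by rewrite !ffunE ko.
  by rewrite sum1_card cardC1 card_ord add2n nK.
have famS i : (\sum_(k < n) (fam (Some i) k).+1 = n * i.+1)%N.
  rewrite (eq_bigr (fun=> i.+1)) => [|k _]; last by rewrite ffunE.
  by rewrite sum_nat_const card_ord.
have neq i : (n * i.+1 <> n.+1)%N.
  move=> E; have: (n %| n.+1)%N by rewrite -E dvdn_mulr.
  by rewrite -addn1 dvdn_addr // dvdn1 gtn_eqF.
have := card_weights_le_dim charF0 e_basis QDerE f0_neq0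
  (A := [set: option 'I_m]) (f := fam) (wt := S) (fun x _ => nz _).
rewrite cardsT card_option card_ord ltnn => absurd.
suff : false by []; apply: absurd.
move=> [i|] [j|] _ _; rewrite ?famN ?famS //.
- by move/eqP; rewrite eqn_pmul2l ?(ltnW n2) // => /eqP[/val_inj->].
- by move/neq.
- by move/esym/neq.
Qed.

End Commutative.

Lemma dim1_iso_La (F : fieldType) n (L : naryAlg F n) (e : 1.-tuple L) :
  basis_of fullv e -> exists a, nary_iso L (La n a).
Proof.
move=> eP; have fe := basis_free eP.
have [phi phiE] : exists phi : 'Hom(L, F^o), phi =1 coord e ord0.
  by apply: linfunP => c u v; rewrite linearP.
have phi1 (i : 'I_1) : phi e`_i = 1 by rewrite phiE coord_free // !ord1.
exists (phi (bracket L (basis_args e [ffun=> ord0]))); exists phi; split.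
  exists (fun c : F => c *: e`_0) => [v|c].
    by rewrite [RHS](coord_basis eP (memvf v)) big_ord1; congr (_ *: _).
  by rewrite linearZ /= (phi1 ord0) [LHS]mulr1.
apply: (multilinear_ext (multilinear_hom _ _) (multilinear_comp_args _ _) eP).
- exact: bracket_multilinear.
- exact: La_bracket_multilinear.
move=> f; have -> : f = [ffun=> ord0] by apply/ffunP => i; rewrite ffunE ord1.
rewrite /= /La_bracket big1 ?mulr1 // => i _.
by rewrite !ffunE phi1.
Qed.

Lemma zero_multiplication_iso_La0 (F : fieldType) n (L : naryAlg F n) :
  nary_iso L (La n 0) -> zero_multiplication L.
Proof.
move=> [phi [bij_phi phiM]] x; apply: (bij_inj bij_phi).
by rewrite phiM linear0 /= /La_bracket mul0r.
Qed.

(** In L_a, rescaling the isomorphism [phi] onto F by [c] replaces [a] by [a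
    / c ^ (n - 1)]; a root [c] of degree n - 1 of [a] makes it 1. *)
Lemma iso_La_product (F : fieldType) n (L : naryAlg F n) a :
  GRing.closed_field_axiom F -> (2 <= n)%N -> a != 0 -> nary_iso L (La n a) ->
  exists mul : L -> L -> L, iso_base_field mul /\
    forall x : {ffun 'I_n -> L}, bracket L x = iterated_mul mul x.
Proof.
move=> clF n2 a0 [phi [[phi' phiK phi'K] phiM]].
have n1_gt0 : (0 < n.-1)%N by rewrite -subn1 subn_gt0.
have [c cE] := closed_field_root a clF n1_gt0.
have c0 : c != 0.
  by apply: contra_neq a0 => c0; rewrite -cE c0 expr0n eqn0Ngt n1_gt0.
pose psi : 'Hom(L, F^o) := c *: phi.
pose psi' (z : F^o) : L := phi' (c^-1 * z).
have psiE v : psi v = c * phi v by rewrite lfunE.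
have psiK : cancel psi psi' by move=> v; rewrite /psi' psiE mulKf.
have psi'K : cancel psi' psi by move=> z; rewrite psiE phi'K mulVKf.
exists (fun x y => psi' (psi x * psi y)); split.
  by exists psi; split=> [|x y]; [exists psi' | rewrite psi'K].
move=> x; apply: (can_inj psiK).
have -> : psi (bracket L x) = \prod_(i < n) (psi (x i) : F).
  under [RHS]eq_bigr do rewrite psiE.
  rewrite big_split prodr_const card_ord psiE phiM /= /La_bracket -cE mulrA.
  rewrite -exprS (ltn_predK n2); congr (_ * _).
  by apply: eq_bigr => i _; rewrite ffunE.
rewrite /iterated_mul -big_enum -(big_map x xpredT (fun v => psi v : F)).
have: map x (enum 'I_n) != [::].
  by rewrite -size_eq0 size_map size_enum_ord -lt0n (ltnW n2).
case: map => //= h s _; rewrite big_cons.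
elim: s h => [|u s IHs] h /=; first by rewrite big_nil mulr1.
by rewrite -IHs psi'K big_cons mulrA.
Qed.

(** * Anticommutative algebras *)

Lemma binary_digits_inj m (b c : 'I_m -> bool) :
  (\sum_(i < m) b i * 2 ^ i = \sum_(i < m) c i * 2 ^ i)%N -> b =1 c.
Proof.
elim: m b c => [|m IHm] b c; first by move=> _ [].
have E (d : 'I_m.+1 -> bool) : (\sum_(i < m.+1) d i * 2 ^ i =
    d ord0 + (\sum_(i < m) d (lift ord0 i) * 2 ^ i).*2)%N.
  rewrite big_ord_recl muln1 -muln2 big_distrl /=; congr (_ + _)%N.
  by apply: eq_bigr => i _; rewrite /bump /= add1n expnSr mulnA.
rewrite !E => bc.
have b0 : b ord0 = c ord0.
  by have := congr1 odd bc; rewrite !oddD !odd_double !addbF !oddb.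
move: bc; rewrite b0 => /addnI/double_inj/IHm bc i.
by case: (unliftP ord0 i) => [j|] ->; [apply: bc | apply: b0].
Qed.

(** These are the weights that separate all the subsets of a basis: a set is
    recovered from the binary digits of its weight. *)
Lemma sum_pow2_inj m : injective (fun S : {set 'I_m} => \sum_(i in S) 2 ^ i)%N.
Proof.
move=> S T /=.
have E (A : {set 'I_m}) : (\sum_(i in A) 2 ^ i = \sum_i (i \in A) * 2 ^ i)%N.
  by rewrite big_mkcond; apply: eq_bigr => i _; case: (i \in A); rewrite ?mul1n.
by rewrite !E => /binary_digits_inj ST; apply/setP.
Qed.

(** Pascal's rule, by induction on [m] from the least case [m = n + 2]. *)
Lemma ltn_bin m n : (2 <= n)%N -> (n.+1 < m)%N -> (m < 'C(m, n))%N.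
Proof.
case: n => [|[|k]] // _; elim: m => // m IHm.
rewrite ltnS leq_eqVlt => /orP[/eqP<-|km].
  rewrite binS [X in (_ + X)%N]binS !binSn.
  by apply: (@leq_trans (k.+3 + 2)); [rewrite addn2 | rewrite leq_add2l].
rewrite binS -addn1 leq_add ?IHm // bin_gt0.
by rewrite 3?ltnW.
Qed.

Lemma inj_factor_perm n (T : Type) (f g : 'I_n -> T) :
  injective f -> (forall i, exists j, f i = g j) ->
  exists s : 'S_n, forall i, f i = g (s i).
Proof.
move=> f_inj /(@fin_all_exists _ (fun=> 'I_n))[s sP].
have s_inj : injective s by move=> i j E; apply: f_inj; rewrite !sP E.
by exists (perm s_inj) => i; rewrite permE.
Qed.

(** An injective [f] misses exactly one value [k]. *)
Lemma inj_factor_lift n (f : 'I_n -> 'I_n.+1) : injective f ->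
  exists (k : 'I_n.+1) (s : 'S_n), forall i, f i = lift k (s i).
Proof.
move=> f_inj.
have /existsP[k fk] : [exists k, k \notin codom f].
  apply: contraT; rewrite negb_exists => /forallP f_onto.
  have: (#|'I_n.+1| <= #|codom f|)%N.
    by apply/subset_leq_card/subsetP => k _; rewrite -[_ \in _]negbK.
  by rewrite card_codom // !card_ord ltnn.
exists k; apply: inj_factor_perm => // i.
case: (unliftP k (f i)) => [j ->|fi]; first by exists j.
by rewrite -fi codom_f in fk.
Qed.

Section Anticommutative.
Variables (F : fieldType) (n : nat) (L : naryAlg F n).
Hypothesis charF0 : [pchar F] =i pred0.
Hypothesis antiL : nary_anticommutative L.

Lemma anticommutative_alternating (x : {ffun 'I_n -> L}) i j :
  i != j -> x i = x j -> bracket L x = 0.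
Proof.
move=> ij xij; have := antiL (tperm i j) x.
have -> : [ffun k => x (tperm i j k)] = x.
  by apply/ffunP => k; rewrite ffunE; case: tpermP => [->|->|].
rewrite odd_tperm ij scaleN1r => /eqP; rewrite -addr_eq0 -mulr2n -scaler_nat.
by rewrite scaler_eq0 ((pcharf0P F).1 charF0) => /eqP.
Qed.

Variables (m : nat) (e : m.-tuple L).
Implicit Types f g : {ffun 'I_n -> 'I_m}.

Lemma bracket_neq0_inj f : bracket L (basis_args e f) != 0 -> injective f.
Proof.
move=> f0 i j fij; apply: contraNeq f0 => ij; apply/eqP.
by apply: (anticommutative_alternating ij); rewrite !ffunE fij.
Qed.

Lemma bracket_basis_perm f g (s : 'S_n) : (forall i, f i = g (s i)) ->
  bracket L (basis_args e f) = (-1) ^+ s *: bracket L (basis_args e g).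
Proof.
move=> fg; rewrite -antiL -basis_args_perm; congr (bracket L (basis_args e _)).
by apply/ffunP => i; rewrite ffunE fg.
Qed.

Hypothesis e_basis : basis_of fullv e.
Hypothesis QDerE : forall d : 'End(L), QDerKS d.
Variable f0 : {ffun 'I_n -> 'I_m}.
Hypothesis f0_neq0 : bracket L (basis_args e f0) != 0.

(** As [f] is injective, shifting the index [f i] changes only the entry
    [i]. *)
Lemma anticommutative_upd_eq0 f i a : injective f ->
  bracket L (basis_args e f) = 0 -> bracket L (basis_args e (upd f i a)) = 0.
Proof.
move=> f_inj f_0; have [d] := basis_shift e_basis QDerE f0_neq0 f a (f i).
rewrite f_0 linear0 (bigD1 i) //= big1 ?addr0 // => k /andP[/eqP/f_inj->].
by rewrite eqxx.
Qed.

(** If the bracket at [f] vanished, so would the bracket at [f0], by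
    induction on the number of places where [f] and [f0] differ. At such a
    place [i], the value [f0 i] is brought to position [i]: by exchanging
    two entries if [f] takes that value elsewhere, and by replacing an entry
    otherwise. Both keep [f] injective. *)
Lemma anticommutative_inj_neq0 f :
  injective f -> bracket L (basis_args e f) != 0.
Proof.
have f0_inj := bracket_neq0_inj f0_neq0.
have [k] := ubnP #|[set i | f i != f0 i]|; elim: k f => // k IHk f lek f_inj.
apply/eqP => f_0.
case: (pickP (fun i => f i != f0 i)) => [i fi|ff0]; last first.
  move: f0_neq0; suff -> : f0 = f by rewrite f_0 eqxx.
  by apply/ffunP => i; apply/esym/eqP/negbFE/ff0.
have step f' : injective f' -> f' i = f0 i ->
    (forall j, j != i -> f j = f0 j -> f' j = f0 j) ->
    bracket L (basis_args e f') != 0.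
  move=> f'_inj f'i f'E; apply: IHk f'_inj; apply: leq_trans (lek : (_ <= k)%N).
  rewrite [X in (_ < X)%N](cardsD1 i) inE fi ltnS.
  apply/subset_leq_card/subsetP => j; rewrite !inE => f'j.
  have ji : j != i by apply: contraNneq f'j => ->; rewrite f'i.
  by rewrite ji; apply: contra f'j => /eqP/(f'E _ ji)/eqP.
have [[j fj]|fi'] := altP (@existsP _ (fun j => f j == f0 i)).
  pose f' : {ffun 'I_n -> 'I_m} := [ffun k => f (tperm i j k)].
  have: bracket L (basis_args e f') != 0.
    apply: step => [|| l li fl].
    - by move=> x y; rewrite !ffunE => /f_inj/perm_inj.
    - by rewrite ffunE tpermL (eqP fj).
    rewrite ffunE tpermD ?fl // 1?eq_sym //; apply: contraNneq li => lj.
    by apply/eqP/f0_inj; rewrite -fl lj (eqP fj).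
  rewrite (@bracket_basis_perm f' f (tperm i j)) ?f_0 ?scaler0 ?eqxx //.
  by move=> l; rewrite ffunE.
have: bracket L (basis_args e (upd f i (f0 i))) != 0.
  have fN j : (f j == f0 i) = false.
    by apply: contraNF fi' => fj; apply/existsP; exists j.
  apply: step => [x y||j ji]; rewrite ?updE ?eqxx ?(negbTE ji) //.
  case: eqP => [->|_]; case: eqP => [->|_] //.
  - by move/esym/eqP; rewrite fN.
  - by move/eqP; rewrite fN.
  - exact: f_inj.
by rewrite anticommutative_upd_eq0 ?eqxx.
Qed.

(** The left side counts the n-subsets of the basis, which have nonzero
    brackets of distinct weights. *)
Lemma anticommutative_bin_le_dim : (0 < n)%N -> ('C(m, n) <= m)%N.
Proof.
move=> n_gt0; pose dflt := f0 (Ordinal n_gt0).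
(* The default value is never reached, as only sets of size n occur. *)
pose fam (S : {set 'I_m}) : {ffun 'I_n -> 'I_m} :=
  [ffun k : 'I_n => nth dflt (enum S) k].
rewrite -{1}(card_ord m) -card_draws.
apply: (card_weights_le_dim charF0 e_basis QDerE f0_neq0 (f := fam)
  (wt := fun j => 2 ^ j)%N) => [S|S T].
  rewrite inE => /eqP Sn; apply: anticommutative_inj_neq0 => i j.
  rewrite !ffunE => /eqP; rewrite nth_uniq ?enum_uniq -?cardE ?Sn //.
  by move/eqP/val_inj.
rewrite !inE => /eqP Sn /eqP Tn.
have E (A : {set 'I_m}) : #|A| = n ->
    (\sum_(k < n) 2 ^ fam A k = \sum_(i in A) 2 ^ i)%N.
  move=> An; rewrite -[RHS]big_enum (big_nth dflt) -cardE An big_mkord.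
  by apply: eq_bigr => k _; rewrite ffunE.
by rewrite !E // => /sum_pow2_inj.
Qed.

End Anticommutative.

Section AnticommutativeDimension.
Variables (F : fieldType) (n : nat) (L : naryAlg F n).
Hypothesis charF0 : [pchar F] =i pred0.
Hypothesis antiL : nary_anticommutative L.
Hypothesis QDerE : forall d : 'End(L), QDerKS d.

(** Up to sign there is only one bracket of distinct basis vectors, so
    nonzero brackets would span a line, whereas they must span L. *)
Lemma anticommutative_dim_n_eq0 (e : n.-tuple L) (f0 : {ffun 'I_n -> 'I_n}) :
  (2 <= n)%N -> basis_of fullv e -> bracket L (basis_args e f0) = 0.
Proof.
move=> n2 eP; apply: contraTeq n2 => f0_neq0.
have f0_inj := bracket_neq0_inj charF0 antiL f0_neq0.
rewrite -leqNgt -{1}(size_basis eP).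
pose line := <[bracket L (basis_args e f0)]>%VS.
rewrite -(brackets_span f0_neq0 QDerE (U := line)).
  by rewrite dim_vline; case: (_ != 0).
apply: (multilinear_mem (@bracket_multilinear _ _ L) eP) => f.
have [->|/(bracket_neq0_inj charF0 antiL) f_inj] :=
  eqVneq (bracket L (basis_args e f)) 0; first exact: mem0v.
have [s sE] : exists s : 'S_n, forall i, f i = f0 (s i).
  apply: inj_factor_perm => // i.
  have /codomP[j ->] : f i \in codom f0 by apply: inj_card_onto.
  by exists j.
by rewrite (bracket_basis_perm antiL _ sE) memvZ ?memv_line.
Qed.

(** Column [i] of [B] holds the coordinates of e^i, the signed bracket of
    all basis vectors but e_i. The coordinate map is multiplicative since
    both sides are alternating and agree on these brackets. If [B] were
    singular, a nonzero linear form [u] with [u B = 0] would vanish on all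
    brackets, which span L. *)
Lemma anticommutative_iso_LB (e : n.+1.-tuple L) (f0 : {ffun 'I_n -> 'I_n.+1}) :
  basis_of fullv e -> bracket L (basis_args e f0) != 0 ->
  exists2 B : 'M[F]_n.+1, B \in unitmx & nary_iso L (LB B).
Proof.
move=> eP f0_neq0; have [phi [phi_bij phiE]] := bijective_coords eP.
pose g (k : 'I_n.+1) : {ffun 'I_n -> 'I_n.+1} := [ffun j => lift k j].
pose B : 'M[F]_n.+1 := \matrix_(k, i)
  ((-1) ^+ (n + i) * phi (bracket L (basis_args e (g i))) 0 k).
have phi_args (f : {ffun 'I_n -> 'I_n.+1}) :
    [ffun i => phi (basis_args e f i)] =
    [ffun i => (delta_mx 0 (f i) : 'rV[F]_n.+1)].
  by apply/ffunP => i; rewrite !ffunE phiE.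
have phiM_basis f : phi (bracket L (basis_args e f)) =
    bracket (LB B) [ffun i => (delta_mx 0 (f i) : 'rV[F]_n.+1)].
  have [f_inj|] := altP (@injectiveP _ _ f); last first.
    case/injectivePn=> i [j ij fij].
    rewrite !(anticommutative_alternating charF0 _ ij) ?linear0 ?ffunE ?fij //.
    exact: LB_anticommutative.
  have [k [s sE]] := inj_factor_lift f_inj.
  have gE i : f i = g k (s i) by rewrite ffunE.
  rewrite (bracket_basis_perm antiL e gE) linearZZ.
  have -> : [ffun i => (delta_mx 0 (f i) : 'rV[F]_n.+1)] =
      [ffun i => [ffun j => (delta_mx 0 (lift k j) : 'rV[F]_n.+1)] (s i)].
    by apply/ffunP => i; rewrite !ffunE sE.
  rewrite LB_anticommutative; congr (_ *: _).
  apply: (scalerI (a := (-1) ^+ (n + k))); first by rewrite signr_eq0.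
  rewrite LB_basis; apply/rowP => l; rewrite !mxE summxE (bigD1 l) //= big1.
    by rewrite !mxE !eqxx mulr1 addr0.
  by move=> l' /negbTE l'l; rewrite !mxE eq_sym l'l andbF mulr0.
have phiM x : phi (bracket L x) = bracket (LB B) [ffun i => phi (x i)].
  move: x; apply: (multilinear_ext (multilinear_hom _ _)
    (multilinear_comp_args _ _) eP).
  - exact: bracket_multilinear.
  - exact: LB_bracket_multilinear.
  by move=> f; have := phiM_basis f; rewrite -phi_args; apply.
exists B; last by exists phi.
rewrite unitmxE unitfE; apply/negP => /det0P[u u0 uB].
have [h hE] : exists h : 'Hom(L, 'rV[F]_1), h =1 fun v => phi v *m u^T.
  by apply: linfunP => c v w; rewrite linearP mulmxDl scalemxAl.
case/negP: u0; apply/eqP/rowP => j; rewrite mxE.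
have : e`_j \in lker h.
  rewrite (brackets_span f0_neq0 QDerE (U := lker h)) ?memvf // => x.
  rewrite memv_ker hE phiM /= /LB_bracket mulmx_suml big1 // => i _.
  by rewrite -scalemxAl -trmx_mul colE mulmxA uB mul0mx trmx0 scaler0.
rewrite memv_ker hE phiE -rowE => /eqP/matrixP/(_ 0 0).
by rewrite !mxE.
Qed.

End AnticommutativeDimension.

(** * Symmetric forms *)

Section SymmetricForms.
Variable F : fieldType.
Hypothesis charF0 : [pchar F] =i pred0.

Lemma form_deltaD N (G : 'M[F]_N) i j
    (x := delta_mx 0 i + delta_mx 0 j : 'rV_N) :
  (x *m G *m x^T) 0 0 = G i i + G j j + (G i j + G j i).
Proof.
rewrite /x linearD /= !trmx_delta mulmxDr !mulmxDl -!rowE -!colE !mxE.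
by rewrite addrACA [G j i + _]addrC addrACA.
Qed.

Lemma form_delta N (G : 'M[F]_N) i (x := delta_mx 0 i : 'rV_N) :
  (x *m G *m x^T) 0 0 = G i i.
Proof. by rewrite /x trmx_delta -rowE -colE !mxE. Qed.

(** Polarization: if G i i = G j j = 0, then e_i + e_j takes the value 2 G i
    j. *)
Lemma symmetric_neq0_anisotropic N (G : 'M[F]_N) :
  G^T = G -> G != 0 -> exists x : 'rV_N, (x *m G *m x^T) 0 0 != 0.
Proof.
move=> Gsym /matrix0Pn[i [j Gij]].
have [Gii|Gii] := eqVneq (G i i) 0; last first.
  by exists (delta_mx 0 i); rewrite form_delta.
have [Gjj|Gjj] := eqVneq (G j j) 0; last first.
  by exists (delta_mx 0 j); rewrite form_delta.
exists (delta_mx 0 i + delta_mx 0 j); rewrite form_deltaD Gii Gjj !add0r.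
rewrite -{2}Gsym mxE -mulr2n -mulr_natl mulf_neq0 //.
by rewrite ((pcharf0P F).1 charF0).
Qed.

Lemma isotropic_skew N (G : 'M[F]_N) :
  (forall x : 'rV_N, (x *m G *m x^T) 0 0 = 0) -> G^T = - G.
Proof.
move=> G0; apply/matrixP => i j; rewrite !mxE.
have Gd k : G k k = 0 by rewrite -form_delta.
have := form_deltaD G i j; rewrite /= G0 !Gd !add0r => /esym/eqP.
by rewrite addrC addr_eq0 => /eqP.
Qed.

(** Induction on [k], the number of orthonormal rows found so far. The rows
    of [K] span the orthogonal complement of the rows of [V], and [1 - B V^T
    V] projects onto it. The form cannot vanish on the complement: [K] would
    then be orthogonal to the whole space, against the invertibility of [B].
    So the complement contains a vector on which the form is not 0, and a
    square root normalizes it. *)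
Lemma exists_orthonormal_rows N (B : 'M[F]_N) k :
  GRing.closed_field_axiom F -> B^T = B -> B \in unitmx -> (k <= N)%N ->
  exists V : 'M[F]_(k, N), V *m B *m V^T = 1%:M.
Proof.
move=> clF Bsym Bu; elim: k => [|k IHk] kN.
  by exists 0; apply/matrixP => -[].
have [V VE] := IHk (ltnW kN); pose K := kermx (B *m V^T).
have KV : K *m B *m V^T = 0 by rewrite -mulmxA mulmx_ker.
have K0 : K != 0.
  rewrite -mxrank_eq0 mxrank_ker subn_eq0 -ltnNge.
  exact: leq_ltn_trans (rank_leq_col _) kN.
have subK (R : 'M_N) : R *m (B *m V^T) = 0 -> (R <= K)%MS.
  by move=> RV; apply/sub_kermxP.
clearbody K; have KK0 : K *m B *m K^T != 0.
  apply: contra_neq K0 => KK0.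
  have /submxP[C RE] : (1%:M - B *m V^T *m V <= K)%MS.
    apply: subK; rewrite mulmxBl mul1mx -!mulmxA (mulmxA V) VE mulmx1.
    by rewrite subrr.
  have I : 1%:M = V^T *m (V *m B) + K^T *m C^T.
    rewrite -[LHS]trmx1 -[1%:M](subrK (B *m V^T *m V)) RE linearD /= !trmx_mul.
    by rewrite trmxK Bsym addrC.
  rewrite -[K](mulmxK Bu) -[K *m B]mulmx1 I mulmxDr !mulmxA KV KK0.
  by rewrite !mul0mx addr0 mul0mx.
have KKsym : (K *m B *m K^T)^T = K *m B *m K^T.
  by rewrite !trmx_mul trmxK Bsym mulmxA.
have [x xK] := symmetric_neq0_anisotropic KKsym KK0.
pose y := x *m K; have yB : (y *m B *m y^T) 0 0 != 0.
  by rewrite /y trmx_mul !mulmxA in xK *.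
have [c cE] := closed_field_root ((y *m B *m y^T) 0 0)^-1 clF (isT : 0 < 2)%N.
pose u := c *: y.
have uu : u *m B *m u^T = 1%:M.
  rewrite [LHS]mx11_scalar; congr (_%:M).
  rewrite linearZ /= -!scalemxAl -scalemxAr scalerA -expr2 cE mxE.
  by rewrite mulVf.
have uV : u *m B *m V^T = 0.
  by rewrite /u /y -!scalemxAl -!mulmxA (mulmxA K) KV mulmx0 scaler0.
suff : col_mx u V *m B *m (col_mx u V)^T = 1%:M by exists (col_mx u V).
rewrite tr_col_mx mul_col_mx mul_col_row uu uV VE.
have -> : V *m B *m u^T = 0.
  by apply: trmx_inj; rewrite !trmx_mul trmxK Bsym mulmxA uV trmx0.
by rewrite -scalar_mx_block.
Qed.

End SymmetricForms.

(** * The cross product of D_{n+1} *)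

Section CrossProduct.
Variables (F : fieldType) (n : nat).
Implicit Types (x y : {ffun 'I_n -> 'rV[F]_n.+1}) (v w z : 'rV[F]_n.+1).
Implicit Types B P D : 'M[F]_n.+1.

Notation cross x := (bracket (Dalg F n) x).

(** The cross product of n vectors is in fact the linear form z -> det (x_1,
    ..., x_n, z), written in coordinates; [B] is the map that turns this
    form into a vector of L_B. *)
Lemma LB_cross B x : bracket (LB B) x = cross x *m B^T.
Proof.
rewrite /= /LB_bracket mulmx_suml; apply: eq_bigr => i _.
by rewrite -scalemxAl -trmx_mul !colE mul1mx.
Qed.

(** [z] is the last row, which makes the signs in [cross_dot] those of the
    definition of L_B. *)
Definition bordered x z : 'M[F]_n.+1 :=
  \matrix_(i, k) (if unlift ord_max i is Some j then x j else z) 0 k.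

Lemma cross_dot x z : (cross x *m z^T) 0 0 = \det (bordered x z).
Proof.
rewrite (expand_det_row _ ord_max) !mxE; apply: eq_bigr => k _.
rewrite !mxE unlift_none mulrC; congr (_ * _).
rewrite /= /LB_bracket summxE (bigD1 k) //= big1 => [|i ik].
  rewrite !mxE eqxx mulr1 addr0; congr (_ * \det _).
  by apply/matrixP => i j; rewrite !mxE liftK.
by rewrite !mxE eq_sym (negbTE ik) mulr0.
Qed.

Lemma row_eq_dot (u v : 'rV[F]_n.+1) :
  (forall z, (u *m z^T) 0 0 = (v *m z^T) 0 0) -> u = v.
Proof.
move=> E; apply/rowP => k; have := E (delta_mx 0 k).
by rewrite trmx_delta -!colE !mxE.
Qed.

(** Dually: the determinant with rows x_1 P, ..., x_n P, z P is det P times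
    the one with rows x_1, ..., x_n, z. *)
Lemma cross_mulmx P x :
  cross [ffun i => x i *m P] *m P^T = \det P *: cross x.
Proof.
apply: row_eq_dot => z; rewrite -mulmxA -trmx_mul cross_dot -scalemxAl [RHS]mxE.
rewrite cross_dot mulrC -det_mulmx; congr (\det _).
apply/matrixP => i k; rewrite !mxE; case: unliftP => [j|] ij.
  rewrite ffunE mxE; apply: eq_bigr => l _.
  by rewrite !mxE ij liftK.
by rewrite mxE; apply: eq_bigr => l _; rewrite !mxE ij unlift_none.
Qed.

(** The derivative of the determinant in the direction M D, by expansion of
    each summand along its modified row: the cofactors there are those of
    [M]. *)
Lemma trace_det (M D : 'M[F]_n.+1) :
  \sum_i \det (\matrix_(a, b) (if a == i then M *m D else M) a b) =
  \tr D * \det M.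
Proof.
transitivity (\tr (M *m D *m \adj M)); last first.
  by rewrite mxtrace_mulC mulmxA mul_adj_mx mul_scalar_mx mxtraceZ mulrC.
apply: eq_bigr => i _; rewrite (expand_det_row _ i) [RHS]mxE.
apply: eq_bigr => k _; have -> : (\adj M) k i = cofactor M i k by rewrite mxE.
rewrite [X in X * _ = _]mxE eqxx; congr (_ * _).
rewrite /cofactor; congr (_ * \det _); apply/matrixP => a b.
by rewrite !mxE eq_sym (negbTE (neq_lift _ _)).
Qed.

(** [trace_det] for the matrix with rows x_1, ..., x_n, z, whose last
    summand is moved to the other side. *)
Lemma cross_derivation D x :
  \sum_(i < n) cross (upd x i (x i *m D)) =
  \tr D *: cross x - cross x *m D^T.
Proof.
apply/eqP; rewrite eq_sym subr_eq; apply/eqP/row_eq_dot => z.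
rewrite mulmxDl mulmx_suml -scalemxAl [LHS]mxE [RHS]mxE summxE.
rewrite -mulmxA -trmx_mul !cross_dot -trace_det.
rewrite (bigD1_ord ord_max) //= addrC; congr (_ + _); last first.
  congr (\det _); apply/matrixP => a b; rewrite !mxE.
  case: unliftP => [j ->|->].
    by rewrite eq_sym (negbTE (neq_lift _ _)) !mxE liftK.
  by rewrite eqxx !mxE; apply: eq_bigr => l _; rewrite !mxE unlift_none.
apply: eq_bigr => i _; rewrite cross_dot; congr (\det _).
apply/matrixP => a b; rewrite !mxE.
case: unliftP => [j ->|->]; last first.
  by rewrite (negbTE (neq_lift _ _)) !mxE unlift_none.
rewrite (inj_eq lift_inj) ffunE.
case: eqP => [->|_]; last by rewrite !mxE liftK.
by rewrite !mxE; apply: eq_bigr => l _; rewrite !mxE liftK.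
Qed.

End CrossProduct.

(** * Filippov algebras *)

Section FilippovLB.
Variables (F : fieldType) (n : nat).
Implicit Types (x y : {ffun 'I_n -> 'rV[F]_n.+1}) (v w : 'rV[F]_n.+1).
Implicit Types B P D : 'M[F]_n.+1.
Hypothesis charF0 : [pchar F] =i pred0.

Notation cross x := (bracket (Dalg F n) x).

Definition unit_args (k : 'I_n.+1) : {ffun 'I_n -> 'rV[F]_n.+1} :=
  [ffun j => delta_mx 0 (lift k j)].

Lemma cross_unit_args k :
  cross (unit_args k) = (-1) ^+ (n + k) *: (delta_mx 0 k : 'rV[F]_n.+1).
Proof. exact: Dalg_basis. Qed.

Lemma cross_separates (M : 'M[F]_n.+1) :
  (forall x, cross x *m M = 0) -> M = 0.
Proof.
move=> M0; apply/row_matrixP => k; have := M0 (unit_args k).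
rewrite cross_unit_args -scalemxAl -rowE row0 => /eqP.
by rewrite scaler_eq0 signr_eq0 => /eqP.
Qed.

(** The skew form obtained by fixing all arguments of the cross product but
    the one at position [z]: its value at (v, w) is the determinant with
    rows y, w in which [v] replaces [y z]. *)
Definition cross_mx y (z : 'I_n) : 'M[F]_n.+1 :=
  lin1_mx (slot (@bracket_multilinear _ _ (Dalg F n)) y z).

Lemma mul_cross_mx y z v : v *m cross_mx y z = cross (upd y z v).
Proof. exact: mul_rV_lin1. Qed.

Lemma cross_mx_skew y z : (cross_mx y z)^T = - cross_mx y z.
Proof.
apply: isotropic_skew => // v; rewrite mul_cross_mx cross_dot.
apply: (determinant_alternate (i1 := lift ord_max z) (i2 := ord_max)).
  by rewrite eq_sym neq_lift.
by move=> k; rewrite !mxE liftK unlift_none updE eqxx.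
Qed.

Lemma exists_unitmx_row (r : 'I_n.+1) v : v != 0 ->
  exists2 P, P \in unitmx & delta_mx 0 r *m P = v.
Proof.
move=> v0; pose f : 'M[F]_n.+1 := delta_mx r 0 *m v.
have fE : (delta_mx 0 r : 'rV_n.+1) *m f = v.
  by rewrite mulmxA mul_delta_mx [delta_mx _ _]mx11_scalar mxE mul1mx.
have [|P Pu] := @complete_unitmx _ _ _ (delta_mx 0 r : 'rV_n.+1) f.
  by rewrite fE mxrank_delta rank_rV v0.
by rewrite fE => Pv; exists P.
Qed.

(** A nonzero [v] is the row at position [z] of an invertible matrix [P];
    the cross product of n rows of an invertible matrix is not 0, by
    [cross_mulmx]. *)
Lemma cross_annihilator v (z o : 'I_n) :
  (forall y, y o != 0 -> v *m cross_mx y z = 0) -> v = 0.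
Proof.
move=> vO; apply/eqP/contraT => v0.
have [P Pu Pv] := exists_unitmx_row (lift ord_max z) v0.
pose y : {ffun 'I_n -> 'rV[F]_n.+1} := [ffun j => unit_args ord_max j *m P].
have yz : y z = v by rewrite !ffunE.
have yo : y o != 0.
  apply/eqP; rewrite ffunE => /(congr1 (mulmx^~ (invmx P))).
  rewrite /= mulmxK // mul0mx ffunE => /rowP/(_ (lift ord_max o)).
  by rewrite !mxE !eqxx => /eqP; rewrite oner_eq0.
have := cross_mulmx P (unit_args ord_max).
have := vO y yo; rewrite mul_cross_mx -yz upd_id => ->.
rewrite mul0mx cross_unit_args => /esym/eqP; rewrite !scaler_eq0 signr_eq0.
move: Pu; rewrite unitmxE unitfE => /negbTE-> /eqP/rowP/(_ ord_max).
by rewrite !mxE !eqxx => /eqP; rewrite oner_eq0.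
Qed.

(** The Filippov identity says that D = W B^T, where W = [cross_mx y z], is
    a derivation of L_B. By [cross_derivation] this becomes B^T D = tr(D)
    B^T - D^T B^T, and as W is skew and B invertible, (B^T - B) W = tr(D) I.
    W kills the vector [y o], as the determinant with two equal rows is 0;
    if this vector is not 0, then tr(D) = 0, and the rows of B^T - B are
    annihilated by all such W. *)
Lemma filippov_LB_sym B :
  (2 <= n)%N -> B \in unitmx -> filippov (LB B) -> B^T = B.
Proof.
move=> n2 Bu [_ fil]; pose z := Ordinal (ltnW n2); pose o := Ordinal n2.
have key y : (B^T - B) *m cross_mx y z = (\tr (cross_mx y z *m B^T))%:M.
  pose D := cross_mx y z *m B^T.
  have DE v : bracket (LB B) (upd y z v) = v *m D.
    by rewrite LB_cross -mul_cross_mx mulmxA.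
  have : B^T *m D - (\tr D *: B^T - D^T *m B^T) = 0.
    apply: cross_separates => x; apply/eqP.
    rewrite mulmxBr subr_eq0 mulmxA -LB_cross -DE fil //.
    under eq_bigr do rewrite DE LB_cross.
    rewrite -mulmx_suml cross_derivation mulmxBl mulmxBr mulmxA.
    by rewrite -scalemxAl -scalemxAr.
  rewrite trmx_mul trmxK cross_mx_skew mulmxN mulNmx opprB => E.
  apply: (can_inj (mulmxK (_ : B^T \in unitmx))); first by rewrite unitmx_tr.
  apply/eqP; rewrite mul_scalar_mx !mulmxBl -subr_eq0 -[X in _ == X]E.
  by rewrite /D !mulmxA addrA.
apply/eqP; rewrite -subr_eq0; apply/eqP/row_matrixP => k; rewrite row0.
apply: (@cross_annihilator _ z o) => y yo; rewrite -row_mul key.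
set t := \tr _; suff -> : t = 0 by rewrite raddf0 row0.
have yO : y o *m cross_mx y z = 0.
  rewrite mul_cross_mx.
  apply: (@anticommutative_alternating _ _ (Dalg F n) charF0 _ _ z o) => //.
    exact: LB_anticommutative.
  by rewrite !updE eqxx.
have Oy : cross_mx y z *m (y o)^T = 0.
  apply: trmx_inj.
  by rewrite trmx_mul trmxK cross_mx_skew mulmxN yO oppr0 trmx0.
have := congr1 (mulmx^~ (y o)^T) (key y); rewrite /= -mulmxA Oy mulmx0.
rewrite mul_scalar_mx => /esym/eqP; rewrite scaler_eq0 => /orP[/eqP//|].
by rewrite -trmx0 (inj_eq trmx_inj) (negbTE yo).
Qed.

(** If the rows of [Q] are orthonormal for B, then Q^T Q is the inverse of
    B. By [cross_mulmx], x -> x P is an isomorphism as soon as B P P^T = det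
    P. For P = t Q^T this reads t^2 = t^(n+1) det Q, whence the choice of
    [t]. *)
Lemma LB_sym_iso_Dalg B : (2 <= n)%N -> GRing.closed_field_axiom F ->
  B^T = B -> B \in unitmx -> nary_iso (LB B) (Dalg F n).
Proof.
move=> n2 clF Bsym Bu.
have [Q QB] := exists_orthonormal_rows charF0 clF Bsym Bu (leqnn _).
have Qu : Q \in unitmx by have [] := mulmx1_unit (etrans (mulmxA _ _ _) QB).
have n1_gt0 : (0 < n.-1)%N by rewrite -subn1 subn_gt0.
have [t tE] := closed_field_root (\det Q)^-1 clF n1_gt0.
have detQ : \det Q != 0 by move: Qu; rewrite unitmxE unitfE.
have t0 : t != 0.
  apply: contraTneq detQ => t0; rewrite negbK -invr_eq0 -tE t0 expr0n.
  by rewrite eqn0Ngt n1_gt0.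
pose P := t *: Q^T.
have Pu : P \in unitmx by rewrite unitmxZ ?unitfE // unitmx_tr.
have PE : B *m P *m P^T = (\det P)%:M.
  have -> : \det P = t ^+ 2.
    have tn : t ^+ n.+1 = t ^+ n.-1 * t ^+ 2.
      by rewrite -exprD addn2 (ltn_predK n2).
    by rewrite detZ det_tr tn tE mulrAC mulVf ?mul1r.
  have -> : P^T = t *: Q by rewrite linearZ /= trmxK.
  rewrite /P -!scalemxAr -!scalemxAl scalerA -expr2.
  rewrite (mulmx1C (etrans (mulmxA _ _ _) QB : Q *m (B *m Q^T) = 1%:M)).
  by rewrite scalemx1.
have [phi phiE] : exists phi : 'Hom('rV[F]_n.+1, 'rV[F]_n.+1), phi =1 mulmx^~ P.
  by apply: linfunP => c u v; rewrite mulmxDl scalemxAl.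
exists phi; split=> [|x].
  by exists (mulmx^~ (invmx P)) => u; rewrite phiE ?mulmxK ?mulmxKV.
apply: (can_inj (mulmxK (_ : P^T \in unitmx))); first by rewrite unitmx_tr.
have -> : [ffun i => phi (x i)] = [ffun i => x i *m P].
  by apply/ffunP => i; rewrite !ffunE phiE.
rewrite cross_mulmx phiE LB_cross Bsym.
by rewrite -(mulmxA _ B) -mulmxA PE mul_mx_scalar.
Qed.

End FilippovLB.

Lemma filippov_iso (F : fieldType) n (L1 L2 : naryAlg F n) :
  nary_iso L1 L2 -> filippov L1 -> filippov L2.
Proof.
move=> [phi [[psi phiK psiK] phiM]] [anti1 fil1].
have phi_args (x : {ffun 'I_n -> L2}) :
    [ffun i => phi ([ffun j => psi (x j)] i)] = x.
  by apply/ffunP => i; rewrite !ffunE psiK.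
have phi_upd (x : {ffun 'I_n -> L1}) i v :
    [ffun j => phi (upd x i v j)] = upd [ffun j => phi (x j)] i (phi v).
  by apply/ffunP => j; rewrite !ffunE; case: eqP.
split=> [s x|x y z z0]; rewrite -(phi_args x).
  rewrite -phiM.
  have := congr1 phi (anti1 s [ffun j => psi (x j)]).
  rewrite linearZ phiM => <-; congr bracket.
  by apply/ffunP => i; rewrite !ffunE.
rewrite -(phi_args y) -phiM -phi_upd -phiM fil1 // linear_sum.
apply: eq_bigr => i _.
by rewrite /= phiM phi_upd phiM phi_upd [in RHS]ffunE.
Qed.

Lemma nary_iso_trans (F : fieldType) n (L1 L2 L3 : naryAlg F n) :
  nary_iso L1 L2 -> nary_iso L2 L3 -> nary_iso L1 L3.
Proof.
move=> [f [bf fM]] [g [bg gM]]; exists (g \o f)%VF; split.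
  by apply: (eq_bij (bij_comp bg bf)) => v; rewrite comp_lfunE.
move=> x; rewrite comp_lfunE fM gM; congr bracket.
by apply/ffunP => i; rewrite !ffunE comp_lfunE.
Qed.

(** * Classification *)

Theorem theorem4p9 (F : fieldType) (n : nat) (L : naryAlg F n)
    (charF0 : [pchar F] =i pred0) (n_ge2 : (2 <= n)%N)
    (QDerE : forall d : 'End(L), QDerKS d) :
  (nary_commutative L ->
     ((exists a : F, nary_iso L (La n a)) \/ zero_multiplication L) /\
     (GRing.closed_field_axiom F ->
        (exists mul : L -> L -> L, iso_base_field mul /\
           forall x : {ffun 'I_n -> L}, bracket L x = iterated_mul mul x) \/
        zero_multiplication L)) /\
  (nary_anticommutative L ->
     ((exists2 B : 'M[F]_n.+1, B \in unitmx & nary_iso L (LB B)) \/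
      zero_multiplication L) /\
     (filippov L -> GRing.closed_field_axiom F ->
        nary_iso L (Dalg F n) \/ zero_multiplication L)).
Proof.
have [m [e eP]] : exists m, exists e : m.-tuple L, basis_of fullv e.
  by exists (\dim {:L}), (vbasis fullv); apply: vbasisP.
case: (pickP (fun f : {ffun 'I_n -> 'I_m} => bracket L (basis_args e f) != 0));
  last first.
  move=> all0; have L0 : zero_multiplication L.
    apply: (multilinear_eq0 (@bracket_multilinear _ _ L) eP) => f.
    by apply/eqP/negbFE/all0.
  by split=> _; split=> *; right.
move=> f0 f0_neq0; split=> [commL|antiL].
  have m1 := commutative_dim1 charF0 eP QDerE f0_neq0 commL n_ge2.
  subst m; have [a isoL] := dim1_iso_La eP.
  split=> [|clF]; first by left; exists a.
  have [a0|a0] := eqVneq a 0; last by left; apply: iso_La_product isoL.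
  by right; apply: zero_multiplication_iso_La0; rewrite -a0.
have [B Bu isoL] : exists2 B : 'M[F]_n.+1, B \in unitmx & nary_iso L (LB B).
  have n_le_m : (n <= m)%N.
    have := leq_card _ (bracket_neq0_inj charF0 antiL f0_neq0).
    by rewrite !card_ord.
  have m_le_n1 : (m <= n.+1)%N.
    rewrite leqNgt; apply/negP => /(ltn_bin n_ge2); apply/negP; rewrite -leqNgt.
    exact: (anticommutative_bin_le_dim charF0 antiL eP QDerE f0_neq0
      (ltnW n_ge2)).
  have [mn|m_neq] := eqVneq m n.
    subst m; case/negP: f0_neq0; apply/eqP.
    exact: anticommutative_dim_n_eq0.
  have mn1 : m = n.+1.
    by apply/eqP; rewrite eqn_leq m_le_n1 ltn_neqAle eq_sym m_neq.
  subst m; exact: (anticommutative_iso_LB charF0 antiL QDerE eP f0_neq0).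
split=> [|filL clF]; left; first by exists B.
have Bsym := filippov_LB_sym charF0 n_ge2 Bu (filippov_iso isoL filL).
exact: (nary_iso_trans isoL (LB_sym_iso_Dalg charF0 n_ge2 clF Bsym Bu)).
Qed.
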